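(* For every integer $r\geq 2$ and every integer $n\geq 3r^2\, r!\,\log r$, $\mathrm{tp}_r(K_n)\leq r$.
   Context: $K_n$ is the complete graph on $n$ vertices and $\log$ is the natural logarithm. The $r$-color tree-partition number $\mathrm{tp}_r(G)$ of a graph $G$ is the minimum $s$ such that for every $r$-coloring of the edges of $G$ (an arbitrary assignment of one of $r$ colors to each edge) there exists a collection of monochromatic connected subgraphs $\{H_1,\dots,H_t\}$ of $G$ with $t\leq s$ such that $\{V(H_1),\dots,V(H_t)\}$ is a partition of $V(G)$. (A single vertex counts as a monochromatic connected subgraph.) *)

(* Defs.v *)
From HB Require Import structures.
From mathcomp Require Import all_boot all_order all_algebra.
From mathcomp Require Import boolp reals exp.

Set Implicit Arguments.
Unset Strict Implicit.
Unset Printing Implicit Defensive.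

Record sgraph := SGraph {
  vertex :> finType;
  adj : rel vertex;
  adj_sym : symmetric adj;
  adj_irrefl : irreflexive adj }.

Definition edge_set (G : sgraph) : {set {set G}} :=
  [set e | [exists x, exists y, adj x y && (e == [set x; y])]].

Definition edge (G : sgraph) := {e : {set G} | e \in edge_set G}.

Record subgraph (G : sgraph) := Subgraph {
  sub_vertices : {set G};
  sub_edges : {set edge G};
  sub_edgesP : forall e, e \in sub_edges -> val e \subset sub_vertices }.

Definition sub_adj (G : sgraph) (H : subgraph G) : rel G :=
  fun x y => [exists e in sub_edges H, val e == [set x; y]].

(* Paths of sub_adj H that start in the vertex set of H stay in it, because
   the edges of H have both ends there. *)
Definition connected (G : sgraph) (H : subgraph G) : Prop :=
  sub_vertices H != set0 /\
  {in sub_vertices H &, forall x y, connect (sub_adj H) x y}.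

(* Stated without naming the common colour, so that a subgraph with no edge
   is monochromatic even when there is no colour at all. *)
Definition monochromatic (G : sgraph) (r : nat) (c : edge G -> 'I_r)
    (H : subgraph G) : Prop :=
  {in sub_edges H &, forall e f, c e = c f}.

Definition tree_partition (G : sgraph) (r : nat) (c : edge G -> 'I_r)
    (t : nat) (H : 'I_t -> subgraph G) : Prop :=
  [/\ forall i, connected (H i) /\ monochromatic c (H i),
      injective (fun i => sub_vertices (H i)) &
      partition [set sub_vertices (H i) | i : 'I_t] [set: G]].

Definition tp_bound (r : nat) (G : sgraph) (s : nat) : Prop :=
  forall c : edge G -> 'I_r,
    exists t (H : 'I_t -> subgraph G), t <= s /\ tree_partition c H.

Lemma single_vertexP (G : sgraph) (x : G) (e : edge G) :
  e \in set0 -> val e \subset [set x].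
Proof. by rewrite inE. Qed.

Definition single_vertex (G : sgraph) (x : G) : subgraph G :=
  Subgraph (@single_vertexP G x).

Lemma tp_bound_card (r : nat) (G : sgraph) : tp_bound r G #|G|.
Proof.
move=> c; exists #|G|, (fun i => single_vertex (enum_val i)); split=> //.
split=> [i|i j /set1_inj /enum_val_inj //|].
  split; last by move=> e f; rewrite inE.
  split=> [|x y]; first by apply/set0Pn; exists (enum_val i); rewrite inE.
  by rewrite !inE => /eqP-> /eqP->.
apply/and3P; split.
- rewrite /cover eqEsubset subsetT; apply/subsetP => x _.
  apply/bigcupP; exists [set x]; last by rewrite inE.
  by apply/imsetP; exists (enum_rank x); rewrite //= enum_rankK.
- apply/trivIsetP => _ _ /imsetP[i _ ->] /imsetP[j _ ->] /= ij.
  by rewrite disjoints1 inE; apply: contraNneq ij => ->.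
- apply/imsetP => -[i _ /setP/(_ (enum_val i))].
  by rewrite !inE eqxx.
Qed.

Lemma tp_bound_ex (r : nat) (G : sgraph) : exists s, `[< tp_bound r G s >].
Proof. by exists #|G|; apply/asboolP; exact: tp_bound_card. Qed.

Definition tp (r : nat) (G : sgraph) : nat := ex_minn (tp_bound_ex r G).

Lemma neq_op_sym (T : eqType) : symmetric (fun x y : T => x != y).
Proof. by move=> x y; rewrite eq_sym. Qed.

Lemma neq_op_irrefl (T : eqType) : irreflexive (fun x y : T => x != y).
Proof. by move=> x; rewrite eqxx. Qed.

Definition complete_graph (n : nat) : sgraph :=
  SGraph (@neq_op_sym 'I_n) (@neq_op_irrefl 'I_n).

(* Main.v *)
Require Import Defs.
From mathcomp Require Import all_boot all_order all_algebra.
From mathcomp Require Import boolp reals sequences exp.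
From mathcomp Require Import zify ring lra.

(** Suppose that distinct vertices [rho i], for [i] in a set [K] of [k] colours,
are joined to a set [A] entirely in colour [i]. Split [A] at random into parts
[A_i]: then [rho i] and [A_i] span a star of colour [i], and another vertex [v]
can be added to one of the stars unless each of its [d] edges to [A] with colour
in [K] goes to a wrong part, which has probability [(1 - 1/k)^d]. If [d] is too
small for the union bound at some [v], then many edges from [v] to [A] share a
colour outside [K], so [v] can serve as a new root, with [A] replaced by that
neighbourhood. It suffices that [#|A|] is at least [u_k] at stage [k], where
[u_k = (r - k) u_(k+1) + k ln n] for [1 < k < r] and [u_r = r ln n]; for [k = 1]
a single edge of the right colour is enough, so [u_1 = (r - 1) u_2]. The
recursion is solved by [u_k = ((r - 1) F (r - k) + 1) ln n], with
[F j = j! * (1/0! + ... + 1/j!)], and [r u_1 <= n - 1] is what the lower bound on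
[n] provides. *)

Set Implicit Arguments.
Unset Strict Implicit.
Unset Printing Implicit Defensive.

Import Order.TTheory GRing.Theory Num.Theory.

(** * Star systems and random splittings *)

Definition mono_rel (V C : finType) (col : V -> V -> C) (f : V -> C) : rel V :=
  fun x y => [&& x != y, f x == f y & col x y == f x].

(* The fibre of [f] over [i] is the vertex set of the tree of colour [i]; the
   value [rho i] is irrelevant when that fibre is empty. *)
Definition mono_labelling (V C : finType) (col : V -> V -> C) : Prop :=
  exists (f : V -> C) (rho : C -> V),
    forall x, connect (mono_rel col f) x (rho (f x)).

(** The condition [rho i != a] keeps roots out of [A]: [col] is arbitrary on the diagonal, so
    colours alone would not. *)
Definition star_system (V C : finType) (col : V -> V -> C) (K : {set C})
    (rho : C -> V) (A : {set V}) : Prop :=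
  {in K &, injective rho} /\
  {in K & A, forall i a, rho i != a /\ col (rho i) a = i}.

(* Union bound: for a uniformly random [p : V -> K], a given [v] fails with
   probability (1 - 1/#|K|)^d, where d counts the [a in A] with
   [col v a \in K]. *)
Lemma exists_hitting_map (W V C : finType) (col : W -> V -> C) (K : {set C})
    (A : {set V}) (O : {set W}) (N : nat) :
  K != set0 -> #|O| < N ->
  {in O, forall v, let d := #|[set a in A | col v a \in K]| in
    N * #|K|.-1 ^ d <= #|K| ^ d} ->
  exists p : V -> C, (forall a, p a \in K) /\
    {in O, forall v, exists2 a, a \in A & col v a = p a}.
Proof.
move=> K0 ON hO; have k0 : 0 < #|K| by rewrite card_gt0.
pose bad v : {set {ffun V -> C}} :=
  [set p in family (fun a => if a \in A then K :\ col v a else K)].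
pose all_maps : {set {ffun V -> C}} := [set p in ffun_on (mem K)].
have card_all : #|all_maps| = #|K| ^ #|V| by rewrite cardsE card_ffun_on.
have card_bad v : v \in O -> N * #|bad v| <= #|K| ^ #|V|.
  move=> vO; have := hO v vO; set D := [set a in A | _] => /= hD.
  (* A map in [bad v] loses one of its [#|K|] choices exactly at the places of [D]; elsewhere in [A]
     the colour [col v a] is not in [K]. *)
  have -> : #|bad v| = #|K|.-1 ^ #|D| * #|K| ^ #|~: D|.
    rewrite cardsE card_family foldrE big_map big_enum /=.
    rewrite (bigID (mem D)) /= -!prod_nat_const; congr (_ * _).
      apply: eq_bigr => a; rewrite inE => /andP[-> aK].
      by rewrite [#|K|](cardsD1 (col v a)) aK.
    apply: eq_big => a; rewrite !inE // => aD.
    case: ifP aD => //= aA aK.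
    by rewrite [RHS](cardsD1 (col v a)) (negPf aK).
  by rewrite mulnA -(cardsC D) expnD leq_mul2r hD orbT.
have [p pall pbad] : exists2 p, p \in all_maps & p \notin \bigcup_(v in O) bad v.
  apply/subsetPn/negP => /subset_leq_card le_all.
  have N0 : 0 < N by apply: leq_ltn_trans ON.
  have : N * #|all_maps| <= #|O| * #|all_maps|.
    apply: leq_trans (leq_mul (leqnn N) le_all) _.
    have card_cup : #|\bigcup_(v in O) bad v| <= \sum_(v in O) #|bad v|.
      apply: (big_ind2 (fun (X : {set _}) s => #|X| <= s)); rewrite ?cards0 //.
      move=> X s Y t Xs Yt; rewrite cardsU.
      by apply: leq_trans (leq_subr _ _) (leq_add Xs Yt).
    apply: leq_trans (leq_mul (leqnn N) card_cup) _.
    rewrite big_distrr -sum_nat_const /= card_all.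
    by apply: leq_sum => v vO; exact: card_bad.
  rewrite leq_mul2r card_all expn_eq0 eqn0Ngt k0 /=.
  by rewrite leqNgt ON.
exists p; split=> [a|v vO]; first by move: pall; rewrite inE => /ffun_onP/(_ a).
move: pbad; apply: contraNP => nex; apply/bigcupP; exists v => //.
rewrite inE; apply/familyP => a; move: pall; rewrite inE => /ffun_onP/(_ a) pa.
case: ifP => // aA; rewrite !inE pa andbT.
by apply: contra_notN nex => /eqP pav; exists a.
Qed.

Lemma star_system_labelling (V C : finType) (col : V -> V -> C) (K : {set C})
    (rho : C -> V) (A : {set V}) :
  (forall x y, col x y = col y x) -> K != set0 -> star_system col K rho A ->
  (forall v, v \notin A -> v \notin rho @: K ->
    let d := #|[set a in A | col v a \in K]| in
    #|V| * #|K|.-1 ^ d <= #|K| ^ d) ->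
  mono_labelling col.
Proof.
move=> colC K0 [rho_inj rhoA] hd.
pose O := ~: (A :|: rho @: K).
(* A root lies outside [O], which makes the union bound strict with [N = #|V|]. *)
have OV : #|O| < #|V|.
  case/set0Pn: K0 => i iK; rewrite -[#|V|](cardsC (A :|: rho @: K)).
  rewrite -[X in X < _]add0n ltn_add2r card_gt0; apply/set0Pn.
  by exists (rho i); rewrite inE imset_f ?orbT.
have [|p [pK pO]] := @exists_hitting_map V V C col K A O #|V| K0 OV.
  by move=> v; rewrite !inE negb_or => /andP[]; exact: hd.
(* The final [p x] is never reached: a vertex that is neither a root nor in [A] lies in [O], where
   [pO] provides a suitable [a]. *)
pose f x := if [pick i in K | rho i == x] is Some i then i
  else if x \in A then p x
  else if [pick a in A | col x a == p a] is Some a then p a else p x.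
have f_rho i : i \in K -> f (rho i) = i.
  move=> iK; rewrite /f; case: pickP => [j /andP[jK /eqP/rho_inj->] //|/(_ i)].
  by rewrite /= iK eqxx.
have f_A a : a \in A -> f a = p a.
  move=> aA; rewrite /f aA; case: pickP => // i /andP[iK /eqP ia].
  by have [] := rhoA i a iK aA; rewrite ia eqxx.
have f_O v : v \in O -> exists2 a, a \in A & f v = p a /\ col v a = p a.
  move=> vO; move: (vO); rewrite !inE negb_or => /andP[/negPf vA vK].
  rewrite /f vA; case: pickP => [i /andP[iK /eqP iv]|_].
    by rewrite -iv imset_f in vK.
  case: pickP => [a /andP[aA /eqP va]|/= no_a]; first by exists a.
  by have [a aA va] := pO v vO; have := no_a a; rewrite aA va eqxx.
have conn_A a : a \in A -> connect (mono_rel col f) a (rho (p a)).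
  move=> aA; have [ne ca] := rhoA _ _ (pK a) aA; apply: connect1.
  by rewrite /mono_rel eq_sym ne f_A // f_rho // colC ca !eqxx.
exists f, rho => x.
have [xA|xA] := boolP (x \in A); first by rewrite f_A //; exact: conn_A.
have [/imsetP[i iK ->]|xK] := boolP (x \in rho @: K); first by rewrite f_rho.
have [|a aA [fx xa]] := f_O x; first by rewrite !inE negb_or xA.
rewrite fx; apply: connect_trans (conn_A a aA); apply: connect1.
rewrite /mono_rel fx xa f_A // !eqxx !andbT.
by apply: contraNneq xA => ->.
Qed.

(** * From labellings to tree partitions *)

Definition color_class (G : sgraph) (r : nat) (c : edge G -> 'I_r)
    (f : G -> 'I_r) (i : 'I_r) : {set edge G} :=
  [set e | (c e == i) && (val e \subset f @^-1: [set i])].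

Lemma color_classP (G : sgraph) (r : nat) (c : edge G -> 'I_r)
    (f : G -> 'I_r) (i : 'I_r) (e : edge G) :
  e \in color_class c f i -> val e \subset f @^-1: [set i].
Proof. by rewrite inE => /andP[]. Qed.

Definition class_subgraph (G : sgraph) (r : nat) (c : edge G -> 'I_r)
    (f : G -> 'I_r) (i : 'I_r) : subgraph G :=
  Subgraph (@color_classP G r c f i).

Lemma tp_bound_labelling (G : sgraph) (r : nat) :
  (forall c : edge G -> 'I_r, exists (f : G -> 'I_r) (rho : 'I_r -> G),
    forall x, connect (sub_adj (class_subgraph c f (f x))) x (rho (f x))) ->
  tp_bound r G r.
Proof.
move=> lab c; have [f [rho frho]] := lab c.
(* Only attained colours are kept, because an empty fibre is not a connected subgraph. *)
pose I := [set f x | x : G]; pose H (j : 'I_#|I|) := class_subgraph c f (enum_val j).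
have inH j x : (x \in sub_vertices (H j)) = (f x == enum_val j) by rewrite !inE.
have H_ne (j : 'I_#|I|) : exists x, f x = enum_val j.
  have : enum_val j \in I by exact: enum_valP.
  by case/imsetP => x _ ->; exists x.
exists #|I|, H; split; first by rewrite -[X in _ <= X]card_ord max_card.
split.
- move=> j; split; last by move=> e e'; rewrite !inE => /andP[/eqP-> _] /andP[/eqP-> _].
  split=> [|x y]; first by have [x fx] := H_ne j; apply/set0Pn; exists x; rewrite inH fx.
  rewrite !inH => /eqP fx /eqP fy; have := frho x; have := frho y.
  rewrite fx fy -/(H j) => cy cx; apply: connect_trans cx _.
  rewrite sym_connect_sym // => u v; rewrite /sub_adj.
  by apply: eq_existsb => e; rewrite setUC.
- move=> j k jk; have [x fx] := H_ne j.
  have : x \in sub_vertices (H k) by rewrite -jk inH fx.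
  by rewrite inH fx => /eqP/enum_val_inj.
apply/and3P; split.
- rewrite /cover eqEsubset subsetT; apply/subsetP => x _; apply/bigcupP.
  have xI : f x \in I by rewrite imset_f.
  exists (sub_vertices (H (enum_rank_in xI (f x)))); first by rewrite imset_f.
  by rewrite inH enum_rankK_in.
- apply/trivIsetP => _ _ /imsetP[j _ ->] /imsetP[k _ ->]; apply: contraR.
  case/pred0Pn => x /=; rewrite !inH => /andP[/eqP -> /eqP/enum_val_inj->].
  by rewrite eqxx.
- apply/imsetP => -[j _ /setP H0]; have [x fx] := H_ne j.
  by have := H0 x; rewrite inH fx eqxx inE.
Qed.

Lemma edge_complete (n : nat) (x y : 'I_n) :
  x != y -> [set x; y] \in edge_set (complete_graph n).
Proof.
by move=> xy; rewrite inE; apply/existsP; exists x;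
apply/existsP; exists y; rewrite /= xy eqxx.
Qed.

(* [i0] is the junk value on the diagonal. *)
Definition pair_color (n r : nat) (c : edge (complete_graph n) -> 'I_r)
    (i0 : 'I_r) (x y : 'I_n) : 'I_r :=
  oapp c i0 (insub [set x; y]).

(** The junk value does no harm: [mono_rel] relates distinct vertices only, so each step of a path
    is an edge. *)
Lemma tp_bound_complete (r n : nat) (i0 : 'I_r) :
  (forall col : 'I_n -> 'I_n -> 'I_r, (forall x y, col x y = col y x) ->
    mono_labelling col) ->
  tp_bound r (complete_graph n) r.
Proof.
move=> lab; apply: tp_bound_labelling => c.
have [x y|f [rho frho]] := lab (pair_color c i0); first by rewrite /pair_color setUC.
exists f, rho => x; have /connectP[p path_p ->] := frho x.
elim: p x path_p => [|y p IH] x //= /andP[/and3P[xy /eqP fxy /eqP cxy] path_p].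
apply: connect_trans (connect1 _) _; last by rewrite fxy; exact: IH.
pose e : edge (complete_graph n) := Sub [set x; y] (edge_complete xy).
apply/existsP; exists e; rewrite SubK eqxx andbT inE SubK.
move: cxy; rewrite /pair_color (_ : insub _ = Some e) /= => [->|]; last exact: insubT.
by rewrite eqxx; apply/subsetP => z; rewrite !inE => /orP[]/eqP->; rewrite ?fxy.
Qed.

(** * Adding roots one at a time *)

Local Open Scope ring_scope.

(** Induction on the number of colours outside [K]. If no new root exists, each of these colours
    takes fewer than [u #|K|.+1] edges from [v] to [A], so more than [u k - (#|C| - k) * u k.+1]
    edges, with [k = #|K|], have colours in [K]. *)
Lemma star_system_extend (R : realFieldType) (V C : finType)
    (col : V -> V -> C) (u : nat -> R) (K : {set C}) (rho : C -> V)
    (A : {set V}) :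
  (forall x y, col x y = col y x) ->
  (forall k d, (0 < k < #|C|)%N ->
    u k - (#|C| - k)%:R * u k.+1 < d%:R -> (#|V| * k.-1 ^ d <= k ^ d)%N) ->
  (forall d, u #|C| <= d%:R -> (#|V| * #|C|.-1 ^ d <= #|C| ^ d)%N) ->
  K != set0 -> star_system col K rho A -> u #|K| <= #|A|%:R ->
  mono_labelling col.
Proof.
move=> colC hu huC; move: {2}(#|C| - #|K|)%N (leqnn (#|C| - #|K|)) => m.
elim: m K rho A => [|m IH] K rho A hm K0 starA uA.
  have KT : K = setT.
    apply/eqP; rewrite eqEcard subsetT cardsT.
    by move: hm; rewrite leqn0 subn_eq0.
  apply: (star_system_labelling colC K0 starA) => v _ _ /=.
  have -> : [set a in A | col v a \in K] = A.
    by apply/setP => a; rewrite KT !inE andbT.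
  by move: uA; rewrite KT cardsT; exact: huC.
have [KC|KC] := leqP #|C| #|K|.
  by apply: IH K0 starA uA; move: KC; rewrite -subn_eq0 => /eqP->.
have [[v [i [vA vK iK hi]]]|no_ext] := pselect (exists v i,
    [/\ v \notin A, v \notin rho @: K, i \notin K &
        u #|K|.+1 <= #|[set a in A | col v a == i]|%:R]).
  have [rho_inj rhoA] := starA.
  pose rho' j := if j == i then v else rho j.
  have rho'K j : j \in K -> rho' j = rho j.
    by move=> jK; rewrite /rho'; case: eqP jK iK => // -> ->.
  have rho'i : rho' i = v by rewrite /rho' eqxx.
  apply: (IH (i |: K) rho' [set a in A | col v a == i]).
  - by rewrite cardsU1 iK addnC subnDA leq_subLR add1n.
  - by apply/set0Pn; exists i; rewrite setU11.
  - split=> [j l /setU1P[->|jK] /setU1P[->|lK] //|j a /setU1P[->|jK]].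
    + by rewrite rho'i rho'K // => vl; rewrite vl imset_f in vK.
    + by rewrite rho'i rho'K // => vl; rewrite -vl imset_f in vK.
    + by rewrite !rho'K //; exact: rho_inj.
    + rewrite inE rho'i => /andP[aA /eqP va]; split=> //.
      by apply: contraNneq vA => ->.
    + by rewrite inE rho'K // => /andP[aA _]; exact: rhoA.
  - by rewrite cardsU1 iK add1n.
apply: (star_system_labelling colC K0 starA) => v vA vK /=.
apply: hu; first by rewrite card_gt0 K0.
set D := [set a in A | _].
have AD : #|A| = (#|D| + \sum_(i in ~: K) #|[set a in A | col v a == i]|)%N.
  rewrite -(cardsID D A); congr (_ + _)%N.
    by congr #|pred_of_set _|; apply/setP => a; rewrite !inE; case: (a \in A).
  rewrite -sum1_card (partition_big (col v) (mem (~: K))) /=; last first.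
    by move=> a; rewrite !inE; case: (a \in A); rewrite ?andbF //= andbT.
  apply: eq_bigr => i; rewrite inE => iK; rewrite -sum1_card.
  apply: eq_bigl => a; rewrite !inE; case: (a \in A) => //=.
  by case: eqP => [->|]; rewrite ?iK ?andbF.
have cK : #|~: K| = (#|C| - #|K|)%N by rewrite -(cardsC K) addKn.
rewrite ltrBlDr; apply: le_lt_trans uA _.
(* The sum is strictly smaller because [~: K] is nonempty. *)
rewrite AD natrD ltrD2l natr_sum -cK mulr_natl -sumr_const.
apply: ltr_sum => [|i iK].
  apply/hasP; have : (0 < #|~: K|)%N by rewrite cK subn_gt0.
  by case/card_gt0P => i iK; exists i; rewrite ?mem_index_enum.
rewrite ltNge; apply/negP => hi; apply: no_ext; exists v, i; split=> //.
by move: iK; rewrite inE.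
Qed.

(** Any vertex [x] can be the first root: by pigeonhole over the colours, one colour class at [x]
    has at least [u 1] of the [#|V| - 1] other vertices. *)
Lemma mono_labelling_of_thresholds (R : realFieldType) (V C : finType)
    (col : V -> V -> C) (u : nat -> R) :
  (forall x y, col x y = col y x) ->
  (forall k d, (0 < k < #|C|)%N ->
    u k - (#|C| - k)%:R * u k.+1 < d%:R -> (#|V| * k.-1 ^ d <= k ^ d)%N) ->
  (forall d, u #|C| <= d%:R -> (#|V| * #|C|.-1 ^ d <= #|C| ^ d)%N) ->
  (0 < #|C|)%N -> #|C|%:R * u 1%N <= #|V|%:R - 1 -> (0 < #|V|)%N ->
  mono_labelling col.
Proof.
move=> colC hu huC C0 hu1 /card_gt0P[x _].
pose N i := [set y | (y != x) && (col x y == i)].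
have [i hi] : exists i, u 1%N <= #|N i|%:R.
  apply: contrapT => noi.
  have : \sum_i #|N i|%:R < \sum_(i : C) u 1%N.
    apply: ltr_sum => [|i _]; last first.
      by rewrite ltNge; apply/negP => hi; apply: noi; exists i.
    by apply/hasP; case/card_gt0P: C0 => i _; exists i; rewrite ?mem_index_enum.
  rewrite sumr_const -mulr_natl ltNge => /negP; apply.
  apply: le_trans hu1 _; rewrite -natr_sum lerBlDr natr1 ler_nat.
  rewrite -cardsT (cardsD1 x) inE add1n ltnS.
  rewrite -sum1_card (partition_big (col x) predT) //=; apply: leq_sum => i _.
  by rewrite -sum1_card; apply/eq_leq/eq_bigl => y; rewrite !inE andbT.
apply: (@star_system_extend R V C col u [set i] (fun=> x) (N i)) => //.
- by apply/set0Pn; exists i; rewrite inE.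
- split=> [j l /set1P-> /set1P-> //|j a /set1P->].
  by rewrite inE eq_sym => /andP[-> /eqP].
- by rewrite cards1.
Qed.

(** * Estimates for logarithms and factorials *)

Lemma ln_le_tangent (R : realType) (x y : R) :
  0 < x -> 0 < y -> ln x <= ln y + x / y - 1.
Proof.
move=> x0 y0; have xy0 : 0 < x / y by rewrite divr_gt0.
have := @le_ln1Dx R (x / y - 1).
have -> : 1 + (x / y - 1) = x / y by ring.
rewrite ln_div ?posrE // => h.
have : ln x - ln y <= x / y - 1 by apply: h; lra.
lra.
Qed.

(** From [1 - 1/k <= exp(-1/k)], the failure probability is at most [exp(-d/k)], hence at most
    [1/n]. *)
Lemma expn_failure_le (R : realType) (n k d : nat) : (0 < n)%N -> (0 < k)%N ->
  k%:R * ln (n%:R : R) <= d%:R -> (n * k.-1 ^ d <= k ^ d)%N.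
Proof.
move=> n0 k0 hd.
have n0' : 0 < n%:R :> R by rewrite ltr0n.
have k0' : 0 < k%:R :> R by rewrite ltr0n.
rewrite -(ler_nat R) natrM !natrX.
have km : k.-1%:R <= k%:R * expR (- k%:R^-1) :> R.
  have := @expR_ge1Dx R (- k%:R^-1); rewrite -(ler_pM2l k0') mulrBr mulr1.
  by rewrite divff ?gt_eqF // -subn1 natrB.
apply: (@le_trans _ _ (n%:R * (k%:R * expR (- k%:R^-1)) ^+ d)).
  by rewrite ler_pM2l // lerXn2r ?nnegrE ?ler0n // mulr_ge0 ?expR_ge0.
rewrite exprMn -expRM_natr mulrCA ger_pMr ?exprn_gt0 //.
rewrite -[n%:R in X in X <= _]lnK ?posrE // -expRD -[leRHS]expR0 ler_expR.
by rewrite mulNr mulrC subr_le0 ler_pdivlMr // mulrC.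
Qed.

(* The quantity [F j] of the header. *)
Fixpoint arrangements (j : nat) : nat :=
  if j is i.+1 then (j * arrangements i).+1 else 1%N.

(** The ratio [F j / j!] increases to e, which is below 11/4; the slack [+ 2] lets the induction
    absorb the [+ 1] of the recursion. *)
Lemma arrangements_le (j : nat) : (1 < j)%N ->
  (4 * arrangements j + 2 <= 11 * j`!)%N.
Proof.
case: j => [|[|j]] // _; elim: j => [|j IH] //.
have -> : arrangements j.+3 = (j.+3 * arrangements j.+2).+1 by [].
have := leq_mul (leqnn j.+3) IH; rewrite [j.+3`!]factS.
by set a := arrangements _; set b := _`!; lia.
Qed.

Lemma fact_le_expn (r : nat) : (2 < r)%N -> (3 * r`! <= 2 * r ^ r.-1)%N.
Proof.
case: r => [|[|[|r]]] // _; elim: r => [|r IH] //.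
rewrite factS /=; apply: (@leq_trans (r.+4 * (2 * r.+3 ^ r.+2))).
  by rewrite mulnCA leq_mul2l IH orbT.
by rewrite mulnCA leq_mul2l /= [X in (_ <= X)%N]expnS leq_mul2l leq_exp2r ?leqnSn.
Qed.

(** Raising [1 + t <= expR t] at a small [t] to the 24th power suffices; the next two bounds use the
    powers 40 and 16. *)
Lemma ln3_le (R : realType) : ln 3%:R <= 113%:R / 100%:R :> R.
Proof.
have h : 1 + 113%:R / 2400%:R <= expR (113%:R / 2400%:R) :> R := expR_ge1Dx _.
have e24 : 113%:R / 100%:R = 24%:R * (113%:R / 2400%:R) :> R by lra.
rewrite -ler_expR lnK ?posrE ?ltr0n // e24 expRM_natl.
apply: (@le_trans _ _ ((1 + 113%:R / 2400%:R) ^+ 24)); first by lra.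
by rewrite lerXn2r ?nnegrE ?expR_ge0 //; lra.
Qed.

Lemma ln2_le (R : realType) : ln 2%:R <= 7%:R / 10%:R :> R.
Proof.
have h : 1 + 7%:R / 400%:R <= expR (7%:R / 400%:R) :> R := expR_ge1Dx _.
have e40 : 7%:R / 10%:R = 40%:R * (7%:R / 400%:R) :> R by lra.
rewrite -ler_expR lnK ?posrE ?ltr0n // e40 expRM_natl.
apply: (@le_trans _ _ ((1 + 7%:R / 400%:R) ^+ 40)); first by lra.
by rewrite lerXn2r ?nnegrE ?expR_ge0 //; lra.
Qed.

Lemma ln3_ge (R : realType) : 21%:R / 20%:R <= ln 3%:R :> R.
Proof.
have h : 1 - 21%:R / 320%:R <= expR (- (21%:R / 320%:R)) :> R := expR_ge1Dx _.
have e16 : - (21%:R / 20%:R) = 16%:R * - (21%:R / 320%:R) :> R by lra.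
rewrite -[leRHS]opprK lerNr -lnV ?posrE ?ltr0n //.
rewrite -ler_expR lnK ?posrE ?invr_gt0 ?ltr0n // e16 expRM_natl.
apply: (@le_trans _ _ ((1 - 21%:R / 320%:R) ^+ 16)); first by lra.
by rewrite lerXn2r ?nnegrE ?expR_ge0 //; lra.
Qed.

(* The tangent of [ln] at the lower bound [n0] on [n] reduces the claim to
   [n = n0]. *)
Lemma tree_threshold (R : realType) (r n : nat) : (2 <= r)%N ->
  3%:R * r%:R ^+ 2 * (r`!)%:R * ln (r%:R : R) <= n%:R ->
  r%:R * ((r.-1 * arrangements r.-1)%:R * ln (n%:R : R)) <= n%:R - 1.
Proof.
case: r => [|[|[|r]]] // _.
  rewrite /= => hn.
  have ln2_ge : 1 / 2%:R <= ln 2%:R :> R.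
    rewrite -[leRHS]opprK lerNr -lnV ?posrE ?ltr0n //.
    have := @ln_le_tangent R 2%:R^-1 1; rewrite ln1 => /(_ _ _)/le_trans; apply; lra.
  have n12 : 12%:R <= n%:R :> R.
    by apply: le_trans hn; rewrite !factS fact0 !muln1; lra.
  have := ln2_le R.
  have n0 : 0 < n%:R :> R by lra.
  (* For [r = 2] the claim is [4 ln n <= n - 1]; given [n >= 12], the tangent at 16 proves it. *)
  have e16 : 0 < 2%:R ^+ 4 :> R by rewrite exprn_gt0.
  have := ln_le_tangent n0 e16; rewrite lnXn ?ltr0n // -mulr_natl; lra.
have : (1 < r.+2)%N by []; move: r.+2 => m m_gt1 /=.
have m2 : 2%:R <= m%:R :> R by rewrite ler_nat.
set L := ln _; set Q := (m.+1`!)%:R => hn.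
have rE : m.+1%:R = m%:R + 1 :> R by rewrite natr1.
have r0 : 0 < m.+1%:R :> R by rewrite ltr0n.
have L_ge : 21%:R / 20%:R <= L.
  by apply: le_trans (ln3_ge R) _; rewrite ler_ln ?posrE ?ltr0n // ler_nat.
have Q6 : 6%:R <= Q by rewrite (_ : 6%N = 3`!) // ler_nat leq_fact.
have C_le : m.+1%:R * (m * arrangements m)%:R <= 11%:R / 4%:R * m%:R * Q.
  have : (m.+1 * m * (4 * arrangements m) <= m.+1 * m * (11 * m`!))%N.
    rewrite leq_mul2l; apply/orP; right.
    exact: leq_trans (leq_addr _ _) (@arrangements_le m m_gt1).
  rewrite -(ler_nat R) !natrM /Q factS natrM; lra.
have Q_le : 3%:R * Q <= 2%:R * m.+1%:R ^+ m.
  by rewrite -natrX -!natrM ler_nat; exact: (@fact_le_expn m.+1).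
pose n0 : R := 3%:R * m.+1%:R ^+ 2 * Q * L.
have ln_n0 : ln n0 <= ln 3%:R + (m%:R + 8%:R / 3%:R) * L - 1.
  have -> : n0 = m.+1%:R ^+ 2 * (3%:R * Q) * L by rewrite /n0; ring.
  have Q0 : 0 < 3%:R * Q by lra.
  have L0 : 0 < L by lra.
  have r20 : 0 < m.+1%:R ^+ 2 :> R by rewrite exprn_gt0.
  have rm0 : 0 < m.+1%:R ^+ m :> R by rewrite exprn_gt0.
  have t0 : 0 < 3%:R / 2%:R :> R by lra.
  have r2Q0 : 0 < m.+1%:R ^+ 2 * (3%:R * Q) by exact: mulr_gt0.
  rewrite lnM ?posrE // lnM ?posrE // lnXn // -/L.
  have lnQ : ln (3%:R * Q) <= ln 2%:R + m%:R * L.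
    apply: (@le_trans _ _ (ln (2%:R * m.+1%:R ^+ m))).
      (* Here [Q_le] enters. *)
      by rewrite ler_ln // posrE mulr_gt0 // ltr0n.
    by rewrite lnM ?posrE ?ltr0n // lnXn // mulr_natl.
  (* The tangent at 3/2 adds [2/3 * L] to the [(m + 2) * L] already present, and its [- ln 2]
     cancels the [ln 2] of [lnQ]. *)
  have := ln_le_tangent L0 t0; rewrite ln_div ?posrE ?ltr0n //; lra.
have n0_n : n0 <= n%:R by [].
have n00 : 0 < n0 by rewrite !mulr_gt0 ?exprn_gt0 //; lra.
have n_pos : 0 < n%:R :> R by lra.
have ln_n := ln_le_tangent n_pos n00.
have lnn0 : 0 <= ln (n%:R : R) by rewrite ln_ge0 // ler1n -(ltr0n R).
rewrite mulrA; apply: le_trans (ler_wpM2r lnn0 C_le) _.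
set D := _ * Q; set B := ln 3%:R + (m%:R + 8%:R / 3%:R) * L - 1.
have D0 : 0 <= D by rewrite !mulr_ge0 //; lra.
have ln3_lb := ln3_ge R; have ln3_ub := ln3_le R.
have BQ : 11%:R / 4%:R * m%:R * B + 1 / 6%:R <= 3%:R * m.+1%:R ^+ 2 * L.
  (* [q] is the coefficient of [L] in the difference of the two sides. After the bounds on [L] and
     [ln 3], a quadratic in [m] remains, with its minimum near 3.35. *)
  pose q : R := m%:R ^+ 2 / 4%:R - 4%:R / 3%:R * m%:R + 3%:R.
  have q0 : 0 <= q.
    by have := sqr_ge0 (m%:R - 8%:R / 3%:R : R); rewrite /q; lra.
  have := ler_wpM2l q0 L_ge.
  have := ler_wpM2l (ler0n R m) ln3_ub.
  have := sqr_ge0 (m%:R - 335%:R / 100%:R : R).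
  by rewrite /q /B rE; lra.
(* As [Q >= 6], the spare 1/6 in [BQ] becomes the [+ 1] that pays for the [- 1] of the goal. *)
have Dn0 : D * B + 1 <= n0.
  have Q0 : 0 <= Q by lra.
  by have := ler_wpM2l Q0 BQ; rewrite /D /n0; lra.
have D_n0 : D <= n0.
  have B1 : 0 <= B - 1.
    by have := ler_wpM2l (ler0n R m) L_ge; rewrite /B; lra.
  by have := mulr_ge0 D0 B1; lra.
have Dln : D * ln n%:R <= D * (B + n%:R / n0 - 1).
  by apply: ler_wpM2l => //; apply: le_trans ln_n _; rewrite /B; lra.
have : D * (n%:R / n0 - 1) <= n0 * (n%:R / n0 - 1).
  by rewrite ler_wpM2r // subr_ge0 ler_pdivlMr // mul1r.
have : n0 * (n%:R / n0) = n%:R by rewrite mulrC divfK ?gt_eqF.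
by move: (n%:R / n0) Dln => t Dln n0t; lra.
Qed.

(** * Solving the recursion for the thresholds *)

Theorem theorem1p5 (R : realType) (r n : nat) (hr : (2 <= r)%N)
    (hn : 3%:R * r%:R ^+ 2 * (r`!)%:R * ln (r%:R : R) <= n%:R) :
  (tp r (complete_graph n) <= r)%N.
Proof.
have hun := tree_threshold hr hn.
have n_gt0 : (0 < n)%N.
  rewrite lt0n; apply: contraTneq hun => ->.
  (* By the convention [ln 0 = 0], [hun] would read [0 <= -1]. *)
  by rewrite ln0 // !mulr0 sub0r lerNr oppr0 ler10.
have r_gt0 : (0 < r)%N by apply: ltn_trans hr.
rewrite /tp; case: ex_minnP => s _; apply; apply/asboolP.
apply: (tp_bound_complete (Ordinal r_gt0)) => col colC.
set T := ln _ in hun.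
pose u k : R := ((if k == 1%N then r.-1 * arrangements r.-1
  else r.-1 * arrangements (r - k) + 1)%N)%:R * T.
have rE : r.-1%:R = r%:R - 1 :> R by rewrite -subn1 natrB.
apply: (@mono_labelling_of_thresholds R _ _ col u) => //; rewrite ?card_ord //.
- move=> k d /andP[k_gt0 kr].
  have [-> | k_neq1] := eqVneq k 1%N; rewrite /u.
    (* Here [u 1 = (r - 1) * u 2], so the hypothesis says only [0 < d], and [0 ^ d = 0]. *)
    move: hr; case: (r) => [|[|m]] // _.
    rewrite /= !subSS !subn0 addn1 natrM mulrA subrr ltr0n => d_gt0.
    by rewrite exp0n // muln0.
  move=> /ltW hd; apply: (@expn_failure_le R) => //; apply: le_trans hd.
  have [j rkj] : exists j, r = (k + j.+1)%N by exists (r - k).-1; lia.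
  rewrite (negPf k_neq1) eqSS (negPf (lt0n_neq0 k_gt0)).
  have -> : (r - k)%N = j.+1 by lia.
  have -> : (r - k.+1)%N = j by lia.
  have kE : k%:R = r%:R - j.+1%:R :> R by rewrite rkj natrD addrK.
  have -> : arrangements j.+1 = (j.+1 * arrangements j + 1)%N by rewrite addn1.
  (* The recursion for [arrangements] gives [u k - (r - k) * u k.+1 = k * T]. *)
  by rewrite !(natrD, natrM) kE rE -/T; lra.
- move=> d; rewrite /u gtn_eqF // subnn muln1 addn1 prednK // => hd.
  exact: (@expn_failure_le R).
Qed.
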